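(* Let $(L,\omega)$ be a finite-dimensional quadratic Lie algebra over a field $F$ of characteristic $0$ and let $r=\sum_i a_i\otimes b_i\in L\otimes L$. Let $R:L\to L$ be the operator defined by $R(a)=\sum_i\omega(b_i,a)a_i$ for all $a\in L$, and let $R^*$ be the adjoint of $R$ with respect to the form $\omega$. Let $\lambda\in F$. Then: 1. If $r$ is a solution of the classical Yang–Baxter equation on $L$, then $R$ is a Rota–Baxter operator of weight $\lambda$ if and only if for all $a,b\in L$ $$[R(a),b]+[R^*(a),b]+\lambda[a,b]\in\ker(R).\qquad(\ast)$$ This is equivalent to: for all $a,b\in L$, $$\sum_{i,j}\omega(b_j,a)\,\omega([b_i,a_j],b)\,a_i+\sum_{i,j}\omega(a_j,a)\,\omega([b_i,b_j],b)\,a_i+\lambda\sum_i\omega(b_i,[a,b])\,a_i=0.$$ 2. Conversely, if $R$ is a Rota–Baxter operator of weight $\lambda$ on $L$, then $r$ is a solution of the classical Yang–Baxter equation on $L$ if and only if $(\ast)$ holds for all $a,b\in L$.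
   Context: A quadratic Lie algebra $(L,\omega)$ is a Lie algebra $L$ together with a non-degenerate bilinear form $\omega$ on $L$ that is invariant: $\omega([a,b],c)=\omega(a,[b,c])$ for all $a,b,c\in L$. The adjoint $R^*$ of $R$ with respect to $\omega$ is defined by $\omega(R(x),y)=\omega(x,R^*(y))$ for all $x,y\in L$. An element $r=\sum_i a_i\otimes b_i\in L\otimes L$ is a solution of the classical Yang–Baxter equation (CYBE) on $L$ if $$\sum_{i,j}\big([a_i,a_j]\otimes b_i\otimes b_j-a_i\otimes[a_j,b_i]\otimes b_j+a_i\otimes a_j\otimes[b_i,b_j]\big)=0 .$$ A map $R:L\to L$ is a Rota–Baxter operator of weight $\lambda\in F$ if $[R(x),R(y)]=R([R(x),y]+[x,R(y)]+\lambda[x,y])$ for all $x,y\in L$. *)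

(* Defs.v *)
From HB Require Import structures.
From mathcomp Require Import all_boot all_order all_algebra.
Set Implicit Arguments.
Unset Strict Implicit.
Unset Printing Implicit Defensive.
Import GRing.Theory VectorInternalTheory.
Local Open Scope ring_scope.

(* Tensor products of finite-dimensional spaces are modelled by coordinates:
   the (k, l) entry of a tensor is its coefficient on e_k (x) f_l, where e and
   f are the bases read off by [v2r]. [tens_universal] below shows
   that this is indeed the tensor product. *)
Definition tensor (F : fieldType) (U V : vectType F) : vectType F :=
  'M[F]_(dim U, dim V).

Definition tens (F : fieldType) (U V : vectType F) (x : U) (y : V) :
    tensor U V :=
  (v2r x)^T *m v2r y.

Notation "x *t y" := (tens x y) (at level 40, left associativity) : ring_scope.

Section TensorTheory.
Variables (F : fieldType) (U V W : vectType F).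

Definition tlift (f : U -> V -> W) (t : tensor U V) : W :=
  \sum_k \sum_l (t : 'M[F]_(_, _)) k l *:
    f (r2v (delta_mx 0 k)) (r2v (delta_mx 0 l)).

Lemma tlift_linear f : linear (tlift f).
Proof.
move=> c s t; rewrite /tlift scaler_sumr -big_split; apply: eq_bigr => k _ /=.
rewrite scaler_sumr -big_split; apply: eq_bigr => l _ /=.
by rewrite !mxE scalerDl scalerA.
Qed.

Lemma tlift_sum f n (t : 'I_n -> tensor U V) :
  tlift f (\sum_i t i) = \sum_i tlift f (t i).
Proof.
pose g := GRing.isLinear.Build _ _ _ _ _ (tlift_linear f).
pose h : {linear tensor U V -> W} := HB.pack (tlift f) g.
exact: (raddf_sum h).
Qed.

Lemma tliftE (f : U -> V -> W) x y :
  bilinear_for *:%R *:%R f -> tlift f (x *t y) = f x y.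
Proof.
case=> fl fr.
pose f1 y : {linear U -> W} :=
  HB.pack (f^~ y) (GRing.isLinear.Build _ _ _ _ _ (fl y)).
pose f2 x : {linear V -> W} :=
  HB.pack (f x) (GRing.isLinear.Build _ _ _ _ _ (fr x)).
have exp (X : vectType F) (z : X) :
    z = \sum_k v2r z 0 k *: r2v (delta_mx 0 k).
  rewrite -{1}[z]v2rK {1}(row_sum_delta (v2r z)) linear_sum.
  by apply: eq_bigr => k _; rewrite linearZ.
have S1 m (c : 'I_m -> F) u z :
    f (\sum_k c k *: u k) z = \sum_k c k *: f (u k) z.
  apply: etrans (linear_sum (f1 z) _ _ _) _.
  by apply: eq_bigr => k _; exact: (linearZ_LR (f1 z)).
have S2 m (c : 'I_m -> F) u z :
    f z (\sum_k c k *: u k) = \sum_k c k *: f z (u k).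
  apply: etrans (linear_sum (f2 z) _ _ _) _.
  by apply: eq_bigr => k _; exact: (linearZ_LR (f2 z)).
rewrite [in RHS](exp U x) [in RHS](exp V y) S1; apply: eq_bigr => k _.
rewrite S2 scaler_sumr; apply: eq_bigr => l _; rewrite scalerA.
by congr (_ *: _); rewrite /tens !mxE big_ord1 !mxE.
Qed.

Lemma tens_bilinear : bilinear_for *:%R *:%R (@tens F U V).
Proof.
split=> [y c x x' | x c y y'] /=; rewrite /tens.
  by rewrite !linearP /= mulmxDl -scalemxAl.
by rewrite linearP /= mulmxDr -scalemxAr.
Qed.

Lemma tens_span (t : tensor U V) :
  t = \sum_k \sum_l (t : 'M[F]_(_, _)) k l *:
        (r2v (delta_mx 0 k) *t r2v (delta_mx 0 l)).
Proof.
rewrite {1}[t]matrix_sum_delta; apply: eq_bigr => k _; apply: eq_bigr => l _.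
by rewrite /tens !r2vK trmx_delta mul_delta_mx.
Qed.

Lemma tens_universal (f : U -> V -> W) : bilinear_for *:%R *:%R f ->
  exists! g : 'Hom(tensor U V, W), forall x y, g (x *t y) = f x y.
Proof.
move=> fP.
pose h : {linear tensor U V -> W} :=
  HB.pack (tlift f) (GRing.isLinear.Build _ _ _ _ _ (tlift_linear f)).
exists (linfun h); split=> [x y | g gP]; first by rewrite lfunE; exact: tliftE.
apply/lfunP => t; rewrite lfunE /= [in RHS](tens_span t) linear_sum.
apply: eq_bigr => k _; rewrite linear_sum; apply: eq_bigr => l _.
by rewrite linearZ /= gP.
Qed.

End TensorTheory.

Section Lie.
Variables (F : fieldType) (L : vectType F).
Implicit Types (br : {bilinear L -> L -> L}) (omega : {biscalar L}).

Definition lie_bracket br : Prop :=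
  (forall x, br x x = 0) /\
  (forall x y z, br x (br y z) + br y (br z x) + br z (br x y) = 0).

Definition nondegenerate_form omega : Prop :=
  (forall x, (forall y, omega x y = 0) -> x = 0) /\
  (forall y, (forall x, omega x y = 0) -> y = 0).

Definition invariant_form br omega : Prop :=
  forall x y z, omega (br x y) z = omega x (br y z).

(* Symmetry of the form is not part of the definition. *)
Definition quadratic_lie br omega : Prop :=
  [/\ lie_bracket br, nondegenerate_form omega & invariant_form br omega].

Definition is_adjoint omega (f g : 'End(L)) : Prop :=
  forall x y, omega (f x) y = omega x (g y).

Definition rota_baxter br (lambda : F) (R : 'End(L)) : Prop :=
  forall x y,
    br (R x) (R y) = R (br (R x) y + br x (R y) + lambda *: br x y).

Definition bracket_sum_in_ker br (lambda : F) (R Rs : 'End(L)) : Prop :=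
  forall x y, br (R x) y + br (Rs x) y + lambda *: br x y \in lker R.

Definition cybe_expr br n (a b : 'I_n -> L) : tensor (tensor L L) L :=
  \sum_i \sum_j (br (a i) (a j) *t b i *t b j
                 - a i *t br (a j) (b i) *t b j
                 + a i *t a j *t br (b i) (b j)).

(* [cybe_expr] only depends on the tensor, so "for every representation" and
   "for some representation" agree: see [CYBE_sum]. *)
Definition CYBE br (r : tensor L L) : Prop :=
  forall n (a b : 'I_n -> L), r = \sum_i a i *t b i -> cybe_expr br a b = 0.

Lemma cybe_expr_indep br n (a b : 'I_n -> L) m (c d : 'I_m -> L) :
  \sum_i a i *t b i = \sum_i c i *t d i -> cybe_expr br a b = cybe_expr br c d.
Proof.
pose Q x y z w : tensor (tensor L L) L :=
  br x z *t y *t w - x *t br z y *t w + x *t z *t br y w.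
have tl (X Y : vectType F) (k : F) (x x' : X) (y : Y) :
  (k *: x + x') *t y = k *: (x *t y) + x' *t y by exact: (tens_bilinear X Y).1.
have tr (X Y : vectType F) (k : F) (x : X) (y y' : Y) :
  x *t (k *: y + y') = k *: (x *t y) + x *t y' by exact: (tens_bilinear X Y).2.
have brl k x x' y : br (k *: x + x') y = k *: br x y + br x' y
  by exact: linearPl.
have brr k x y y' : br x (k *: y + y') = k *: br x y + br x y'
  by exact: linearPr.
have AC (k : F) (p q s p' q' s' : tensor (tensor L L) L) :
    k *: p + p' - (k *: q + q') + (k *: s + s') =
    k *: (p - q + s) + (p' - q' + s').
  by rewrite !scalerDr scalerN opprD (addrACA (k *: p)) (addrACA (_ - _)).
have Q1 k x x' y z w : Q (k *: x + x') y z w = k *: Q x y z w + Q x' y z w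
  by rewrite /Q !(brl, brr, tl, tr) AC.
have Q2 k x y y' z w : Q x (k *: y + y') z w = k *: Q x y z w + Q x y' z w
  by rewrite /Q !(brl, brr, tl, tr) AC.
have Q34 x y : bilinear_for *:%R *:%R (Q x y).
  by split=> [w k z z' | z k w w'] /=; rewrite /Q !(brl, brr, tl, tr) AC.
have lin2 (k : F) (f g h : L -> L -> tensor (tensor L L) L) s :
    (forall z w, f z w = k *: g z w + h z w) ->
    tlift f s = k *: tlift g s + tlift h s.
  move=> fgh; rewrite /tlift scaler_sumr -big_split; apply: eq_bigr => i _ /=.
  rewrite scaler_sumr -big_split; apply: eq_bigr => j _ /=.
  by rewrite fgh scalerDr !scalerA mulrC.
have exprE p (u v : 'I_p -> L) (s := \sum_i u i *t v i) :
    cybe_expr br u v = tlift (fun x y => tlift (Q x y) s) s.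
  rewrite {2}/s tlift_sum; apply: eq_bigr => i _.
  rewrite tliftE; last first.
    split=> [y k x x' | x k y y'] /=; apply: lin2 => z w;
      [exact: Q1 | exact: Q2].
  by rewrite tlift_sum; apply: eq_bigr => j _; rewrite tliftE.
by move=> rE; rewrite !exprE rE.
Qed.

Lemma CYBE_sum br n (a b : 'I_n -> L) :
  CYBE br (\sum_i a i *t b i) <-> cybe_expr br a b = 0.
Proof.
split=> [|ab0 m c d /cybe_expr_indep <-//]; exact.
Qed.

Lemma adjoint_exists omega (f : 'End(L)) : nondegenerate_form omega ->
  exists! g : 'End(L), is_adjoint omega f g.
Proof.
case=> _ ndr.
pose e k : L := r2v (delta_mx 0 k).
have ext (p q : {linear L -> F^o}) : (forall k, p (e k) = q (e k)) -> p =1 q.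
  move=> pq x; rewrite -[x]v2rK (row_sum_delta (v2r x)) !linear_sum.
  by apply: eq_bigr => k _; rewrite !linearZ /= pq.
pose form y : {linear L -> F^o} :=
  HB.pack (omega^~ y) (GRing.isLinear.Build _ _ _ _ (omega^~ y)
    (fun c => linearPl omega y c)).
pose flat (y : L) : 'rV[F]_(dim L) := \row_k omega (e k) y.
pose flatf (y : L) : 'rV[F]_(dim L) := \row_k omega (f (e k)) y.
have flatP : linear flat by move=> c x y; apply/rowP => k; rewrite !mxE linearPr.
have flatfP : linear flatf by move=> c x y; apply/rowP => k; rewrite !mxE linearPr.
pose Phi : 'Hom(L, 'rV[F]_(dim L)) :=
  linfun (HB.pack flat (GRing.isLinear.Build _ _ _ _ _ flatP)
          : {linear L -> 'rV[F]_(dim L)}).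
pose Psi : 'Hom(L, 'rV[F]_(dim L)) :=
  linfun (HB.pack flatf (GRing.isLinear.Build _ _ _ _ _ flatfP)
          : {linear L -> 'rV[F]_(dim L)}).
have adjE g : is_adjoint omega f g <-> forall y, Phi (g y) = Psi y.
  split=> [gP y | gP x y].
    by apply/rowP => k; rewrite !lfunE /= !mxE gP.
  apply: (ext (form y \o f) (form (g y))) => k /=.
  by have /rowP/(_ k) := gP y; rewrite !lfunE /= !mxE.
have kerPhi : lker Phi == 0%VS.
  apply/lker0P => x y /rowP xy; apply/eqP; rewrite -subr_eq0; apply/eqP/ndr => z.
  rewrite linearBr; apply/eqP; rewrite subr_eq0; apply/eqP.
  apply: (ext (form x) (form y)) => k /=.
  by have := xy k; rewrite !lfunE /= !mxE.
have fullPhi : limg Phi = fullv.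
  apply/eqP; rewrite eqEdim subvf (limg_dim_eq _) ?(eqP kerPhi) ?capv0 //.
  by rewrite !dimvf /= /dim /= mul1n.
exists (Phi^-1 \o Psi)%VF; split=> [|g /adjE gP].
  by apply/adjE => y; rewrite comp_lfunE limg_lfunVK // fullPhi memvf.
by apply/lfunP => y; rewrite comp_lfunE -gP lker0_lfunK.
Qed.

End Lie.

(* Main.v *)
From HB Require Import structures.
Require Import Defs.
From mathcomp Require Import all_boot all_order all_algebra.
Set Implicit Arguments.
Unset Strict Implicit.
Unset Printing Implicit Defensive.
Import GRing.Theory VectorInternalTheory.
Local Open Scope ring_scope.

(** Applying [omega (-, x)] to the second factor and [omega (-, y)] to the third
    factor of the left-hand side of the CYBE gives
    [R x, R y] - R [x, R y] + R [R^* x, y].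
    As the form is nondegenerate, the CYBE is equivalent to the vanishing of all
    these expressions, and its difference with the Rota-Baxter identity is
    R ([R x, y] + [R^* x, y] + lambda [x, y]). *)

Section Contraction.
Variables (F : fieldType) (U L : vectType F) (omega : {biscalar L}).

(** The map id (x) [omega (-, y)] from U (x) L to U. *)
Definition contract (y : L) (t : tensor U L) : U :=
  tlift (fun u w => omega w y *: u) t.

HB.instance Definition _ y :=
  GRing.isLinear.Build _ _ _ _ (contract y)
    (tlift_linear (fun u w => omega w y *: u)).

Lemma contract_tens y u w : contract y (u *t w) = omega w y *: u.
Proof.
rewrite /contract tliftE //; split=> [w' c v v' | v c w' w''] /=.
  by rewrite scalerDr !scalerA mulrC.
by rewrite linearPl scalerDl scalerA.
Qed.

(** Write [t] as the sum of e_k (x) w_k, with w_k the vector whose coordinates are row [k]. The k-th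
    coordinate of [contract y t] is [omega w_k y], so every w_k lies in the left radical. *)
Lemma contract_eq0 (t : tensor U L) :
  (forall x, (forall y, omega x y = 0) -> x = 0) ->
  (forall y, contract y t = 0) -> t = 0.
Proof.
move=> ndl t0; apply/row_matrixP => k; rewrite row0.
apply: r2v_inj; rewrite linear0.
apply: ndl => y.
have /(congr1 v2r)/rowP/(_ k) := t0 y.
rewrite /contract /tlift [v2r 0]linear0 linear_sum /= summxE mxE => t0k.
(* Only the terms with first factor e_k reach coordinate [k]. *)
rewrite -[RHS]t0k (bigD1 k) //= [X in _ = _ + X]big1 => [|k' k'k]; last first.
  rewrite linear_sum summxE big1 // => l _.
  by rewrite !linearZ /= r2vK !mxE eq_sym (negPf k'k) !mulr0.
rewrite addr0 linear_sum summxE [row k t]row_sum_delta linear_sum linear_sumlz.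
apply: eq_bigr => l _.
by rewrite !linearZ /= linearZl_LR r2vK !mxE !eqxx mulr1.
Qed.

End Contraction.

Section QuadraticLie.
Variables (F : fieldType) (L : vectType F).
Variables (br : {bilinear L -> L -> L}) (omega : {biscalar L}).
Hypothesis quadL : quadratic_lie br omega.

Lemma brC x y : br x y = - br y x.
Proof.
have [[alt _] _ _] := quadL; apply/eqP; rewrite -addr_eq0; apply/eqP.
by have := alt (x + y); rewrite linearDl !linearDr /= !alt add0r addr0.
Qed.

(** Invariance and antisymmetry give w([x,y],z) = w(x,[y,z]) = -w([x,z],y) = w([z,x],y) =
    w(z,[x,y]). *)
Lemma omega_derivedC x y z : omega (br x y) z = omega z (br x y).
Proof.
have [_ _ inv] := quadL.
by rewrite inv brC linearNr -inv (brC x z) linearNl opprK inv.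
Qed.

(* [omega] need not be symmetric, but its antisymmetric part vanishes on the
   derived algebra, so the two transposes of an operator differ by central
   elements. *)
Lemma br_transpose u v y :
  (forall x, omega u x = omega x v) -> br u y = br v y.
Proof.
have [_ [_ ndr] inv] := quadL => uv.
apply/eqP; rewrite -subr_eq0; apply/eqP; apply: ndr => x.
by rewrite linearBr /= -!omega_derivedC !inv uv omega_derivedC subrr.
Qed.

Variables (n : nat) (a b : 'I_n -> L) (R Rs : 'End(L)).
Hypothesis RE : forall x, R x = \sum_i omega (b i) x *: a i.
Hypothesis RsE : is_adjoint omega R Rs.

(** The vector u = sum_j w(a_j,x) b_j satisfies w(u,z) = w(R z,x) = w(z,Rs x). For a non-symmetric
    form it may differ from [Rs x], but [br_transpose] gives both the same brackets. *)
Lemma br_adjointE x y : br (Rs x) y = \sum_j omega (a j) x *: br (b j) y.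
Proof.
transitivity (br (\sum_j omega (a j) x *: b j) y); last first.
  by rewrite linear_sumlz; apply: eq_bigr => j _; rewrite linearZl_LR.
apply/esym/br_transpose => z; rewrite -RsE RE !linear_sumlz.
by apply: eq_bigr => j _; rewrite !linearZl_LR /= mulrC.
Qed.

Lemma R_br_R x y :
  R (br (R x) y) =
    \sum_i \sum_j (omega (b j) x * omega (br (b i) (a j)) y) *: a i.
Proof.
have [_ _ inv] := quadL.
rewrite RE; apply: eq_bigr => i _; rewrite -scaler_suml; congr (_ *: _).
rewrite -inv RE linear_sumr linear_sumlz; apply: eq_bigr => j _.
by rewrite linearZr_LR linearZl_LR.
Qed.

Lemma R_br_adjoint x y :
  R (br (Rs x) y) =
    \sum_i \sum_j (omega (a j) x * omega (br (b i) (b j)) y) *: a i.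
Proof.
have [_ _ inv] := quadL.
rewrite RE; apply: eq_bigr => i _; rewrite -scaler_suml; congr (_ *: _).
rewrite br_adjointE linear_sumr; apply: eq_bigr => j _.
by rewrite linearZr_LR inv.
Qed.

Lemma contract_cybe x y :
  contract omega x (contract omega y (cybe_expr br a b)) =
    br (R x) (R y) - R (br x (R y)) + R (br (Rs x) y).
Proof.
have -> : br (R x) (R y) =
    \sum_i \sum_j (omega (b j) y * omega (b i) x) *: br (a i) (a j).
  rewrite !RE linear_sumlz; apply: eq_bigr => i _.
  rewrite linear_sumr; apply: eq_bigr => j _.
  by rewrite linearZr_LR linearZl_LR scalerA.
have -> : R (br x (R y)) =
    \sum_i \sum_j (omega (b j) y * omega (br (a j) (b i)) x) *: a i.
  (* One sign brings [R y] to the left for [R_br_R]; a second one turns [b_i,a_j] into the [a_j,b_i]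
     of the CYBE. *)
  rewrite (brC x) linearN /= R_br_R -sumrN; apply: eq_bigr => i _.
  rewrite -sumrN; apply: eq_bigr => j _.
  by rewrite (brC (b i)) linearNl mulrN scaleNr opprK.
rewrite R_br_adjoint -sumrB -big_split /cybe_expr.
rewrite (linear_sum (contract omega y)) (linear_sum (contract omega x)) /=.
apply: eq_bigr => i _ /=; rewrite -sumrB -big_split.
rewrite (linear_sum (contract omega y)) (linear_sum (contract omega x)) /=.
apply: eq_bigr => j _ /=.
rewrite (linearD (contract omega y)) (linearB (contract omega y)) /=.
rewrite (linearD (contract omega x)) (linearB (contract omega x)) /=.
rewrite !contract_tens 3!(linearZ_LR (contract omega x)) /= !contract_tens.
by rewrite !scalerA [omega (a j) x * _]mulrC.
Qed.

Lemma CYBE_operatorP :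
  cybe_expr br a b = 0 <->
  forall x y, br (R x) (R y) = R (br x (R y)) - R (br (Rs x) y).
Proof.
have [_ [ndl _] _] := quadL; split=> [E x y | E].
  have := contract_cybe x y; rewrite E !linear0 => /esym/eqP.
  by rewrite addrAC subr_eq0 eq_sym -subr_eq => /eqP <-.
(* Nondegeneracy is used in the third tensor factor, then in the second. *)
apply: (contract_eq0 ndl) => y; apply: (contract_eq0 ndl) => x.
by rewrite contract_cybe E addrAC subrK subrr.
Qed.

(** The Rota-Baxter identity and the CYBE each prescribe a value for [br (R x) (R y)]. The kernel
    condition says that the two values agree, so any two of the three conditions imply the third. *)
Lemma bracket_sum_in_kerP lambda :
  bracket_sum_in_ker br lambda R Rs <->
  forall x y, R (br (R x) y + br x (R y) + lambda *: br x y) =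
    R (br x (R y)) - R (br (Rs x) y).
Proof.
have E x y : R (br (R x) y + br x (R y) + lambda *: br x y) =
    R (br (R x) y + br (Rs x) y + lambda *: br x y) +
    (R (br x (R y)) - R (br (Rs x) y)).
  rewrite -linearB -linearD /=; congr (R _).
  by rewrite [RHS]addrAC [X in _ = X + _]addrACA subrr addr0.
split=> K x y.
  by have := K x y; rewrite memv_ker E => /eqP ->; rewrite add0r.
rewrite memv_ker -(inj_eq (addIr (R (br x (R y)) - R (br (Rs x) y)))).
by rewrite -E add0r K.
Qed.

End QuadraticLie.

Theorem theorem1 (F : fieldType) (charF0 : [pchar F] =i pred0)
    (L : vectType F) (br : {bilinear L -> L -> L}) (omega : {biscalar L})
    (quadL : quadratic_lie br omega)
    (r : tensor L L) (n : nat) (a b : 'I_n -> L)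
    (rE : r = \sum_i a i *t b i)
    (R : 'End(L)) (RE : forall x, R x = \sum_i omega (b i) x *: a i)
    (Rs : 'End(L)) (RsE : is_adjoint omega R Rs)
    (lambda : F) :
  (CYBE br r -> (rota_baxter br lambda R <-> bracket_sum_in_ker br lambda R Rs)) /\
  (bracket_sum_in_ker br lambda R Rs <->
     forall x y,
       \sum_i \sum_j (omega (b j) x * omega (br (b i) (a j)) y) *: a i
       + \sum_i \sum_j (omega (a j) x * omega (br (b i) (b j)) y) *: a i
       + lambda *: \sum_i omega (b i) (br x y) *: a i = 0) /\
  (rota_baxter br lambda R -> (CYBE br r <-> bracket_sum_in_ker br lambda R Rs)).
Proof.
have cybeP : CYBE br r <-> forall x y,
    br (R x) (R y) = R (br x (R y)) - R (br (Rs x) y).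
  (* Independence of the representation of [r] reduces [CYBE] to the given [a] and [b]. *)
  rewrite rE; apply: iff_trans (CYBE_sum br a b) _.
  exact (CYBE_operatorP quadL RE RsE).
have kerP := bracket_sum_in_kerP br R Rs lambda.
split; [|split].
- move=> /cybeP E; split=> [H | /kerP H x y]; last by rewrite H E.
  by apply/kerP => x y; rewrite -H E.
- have E x y : R (br (R x) y + br (Rs x) y + lambda *: br x y) =
      \sum_i \sum_j (omega (b j) x * omega (br (b i) (a j)) y) *: a i
      + \sum_i \sum_j (omega (a j) x * omega (br (b i) (b j)) y) *: a i
      + lambda *: \sum_i omega (b i) (br x y) *: a i.
    rewrite !linearD linearZ /= (R_br_R quadL RE) -RE.
    by rewrite (R_br_adjoint quadL RE RsE).
  by split=> K x y; have := K x y; rewrite memv_ker E => /eqP.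
- move=> E; split=> [/cybeP H | /kerP H].
    by apply/kerP => x y; rewrite -E H.
  by apply/cybeP => x y; rewrite E H.
Qed.
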